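(* There exist positive constants $L_M,L_{C_1},L_{C_2}$ such that $$\|\tilde{\mathbf{M}}(\mathbf{q}_1)-\tilde{\mathbf{M}}(\mathbf{q}_2)\|\le L_M\|\mathbf{q}_1-\mathbf{q}_2\|,$$ $$\|\tilde{\mathbf{C}}(\mathbf{q}_1,\dot{\mathbf{q}}_1)-\tilde{\mathbf{C}}(\mathbf{q}_2,\dot{\mathbf{q}}_2)\|\le L_{C_1}\|\mathbf{q}_1-\mathbf{q}_2\|+L_{C_2}\|\dot{\mathbf{q}}_1-\dot{\mathbf{q}}_2\|$$ for all $(\mathbf{q}_1,\dot{\mathbf{q}}_1)$ and $(\mathbf{q}_2,\dot{\mathbf{q}}_2)$ in the operating domain.
   Context: $\|\cdot\|$ is the Euclidean norm on vectors and the induced $2$-norm on matrices. Parameters $m,I,I_\varphi,I_\delta,r,a,b>0$ and $A=\frac{a}{2(a^2+b^2)}$. Configurations are $\mathbf{q}=[x\ y\ \theta\ \varphi\ \delta_f\ \delta_r]^{\mathrm T}\in\mathbb{R}^6$ and generalized velocities $\dot{\mathbf{q}}=[\dot x\ \dot y\ \dot\theta\ \dot\varphi\ \dot\delta_f\ \dot\delta_r]^{\mathrm T}\in\mathbb{R}^6$. The operating domain consists of those $(\mathbf{q},\dot{\mathbf{q}})$ with $\delta_f,\delta_r\in\mathcal{D}_\delta$ and $|\dot\delta_f|,|\dot\delta_r|\le\dot\delta_{\max}$, for a given compact set $\mathcal{D}_\delta\subset\mathbb{R}$ and $\dot\delta_{\max}>0$. The matrices are $\tilde{\mathbf{M}}(\mathbf{q})=\mathrm{diag}(\tilde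 M_{11},2I_\delta,2I_\delta)$ with $$\tilde M_{11}=\frac{4I_\varphi}{r^2}+\frac m2(1+\cos(\delta_f-\delta_r))+IA^2(\sin\delta_f-\sin\delta_r)^2,$$ and $\tilde{\mathbf{C}}(\mathbf{q},\dot{\mathbf{q}})=\mathrm{diag}(\tilde C_{11},0,0)$ with $$\tilde C_{11}=IA^2(\sin\delta_f-\sin\delta_r)(\cos\delta_f\,\dot\delta_f-\cos\delta_r\,\dot\delta_r)-\frac m4\sin(\delta_f-\delta_r)(\dot\delta_f-\dot\delta_r).$$ *)

(* Defs.v *)
From HB Require Import structures.
From mathcomp Require Import all_boot all_order all_algebra.
From mathcomp Require Import all_classical all_reals all_analysis.

Set Implicit Arguments.
Unset Strict Implicit.
Unset Printing Implicit Defensive.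

Import Order.TTheory GRing.Theory Num.Theory.
Import numFieldNormedType.Exports.

Local Open Scope classical_set_scope.
Local Open Scope ring_scope.

(* The norm `|_| that the library puts on matrices is the max norm, hence the
   two definitions below. *)
Definition norm2 (R : realType) (n : nat) (v : 'cV[R]_n) : R :=
  Num.sqrt (\sum_(i < n) v i 0 ^+ 2).

Definition opnorm2 (R : realType) (m n : nat) (B : 'M[R]_(m, n)) : R :=
  sup [set norm2 (B *m v) | v in [set v : 'cV[R]_n | norm2 v <= 1]].

(* [sup] defaults to 0 on sets without a supremum; this never occurs here. *)
Lemma opnorm2_has_sup (R : realType) (m n : nat) (B : 'M[R]_(m, n)) :
  has_sup [set norm2 (B *m v) | v in [set v : 'cV[R]_n | norm2 v <= 1]].
Proof.
split.
  exists (norm2 (B *m 0)), 0 => //=.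
  rewrite /norm2 big1 ?sqrtr0 ?ler01 // => i _.
  by rewrite mxE expr0n.
exists (Num.sqrt (\sum_(i < m) (\sum_(j < n) `|B i j|) ^+ 2)) => _ [v /= v1 <-].
have vj j : `|v j 0| <= 1.
  apply: le_trans v1; rewrite -sqrtr_sqr /norm2 ler_sqrt; last first.
    by apply: sumr_ge0 => i _; exact: sqr_ge0.
  rewrite (bigD1 j) //= lerDl.
  by apply: sumr_ge0 => i _; exact: sqr_ge0.
rewrite /norm2 ler_sqrt; last by apply: sumr_ge0 => i _; exact: sqr_ge0.
apply: ler_sum => i _; rewrite -[leLHS]real_normK ?num_real //.
rewrite ler_pXn2r ?nnegrE ?sumr_ge0 // mxE.
apply: le_trans (ler_norm_sum _ _ _) _; apply: ler_sum => j _.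
by rewrite normrM ler_piMr.
Qed.

(* Configurations are ordered [x y theta phi delta_f delta_r]; applied to a
   velocity vector, the two projections give the steering rates. *)
Definition delta_f (R : realType) (q : 'cV[R]_6) : R :=
  q (Ordinal (isT : 4 < 6)%N) 0.
Definition delta_r (R : realType) (q : 'cV[R]_6) : R :=
  q (Ordinal (isT : 5 < 6)%N) 0.

Definition operating_domain (R : realType) (Ddelta : set R) (ddelta_max : R)
    : set ('cV[R]_6 * 'cV[R]_6) :=
  [set p | [/\ Ddelta (delta_f p.1), Ddelta (delta_r p.1),
               `|delta_f p.2| <= ddelta_max & `|delta_r p.2| <= ddelta_max]].

Definition geomA (R : realType) (a b : R) : R := a / (2 * (a ^+ 2 + b ^+ 2)).

Definition M11 (R : realType) (m I Iphi r a b : R) (q : 'cV[R]_6) : R :=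
  4 * Iphi / r ^+ 2 + m / 2 * (1 + cos (delta_f q - delta_r q))
  + I * geomA a b ^+ 2 * (sin (delta_f q) - sin (delta_r q)) ^+ 2.

Definition Mtilde (R : realType) (m I Iphi Idelta r a b : R) (q : 'cV[R]_6)
    : 'M[R]_3 :=
  diag_mx (\row_(i < 3)
    [:: M11 m I Iphi r a b q; 2 * Idelta; 2 * Idelta]`_i).

Definition C11 (R : realType) (m I a b : R) (q dq : 'cV[R]_6) : R :=
  I * geomA a b ^+ 2 * (sin (delta_f q) - sin (delta_r q))
    * (cos (delta_f q) * delta_f dq - cos (delta_r q) * delta_r dq)
  - m / 4 * sin (delta_f q - delta_r q) * (delta_f dq - delta_r dq).

Definition Ctilde (R : realType) (m I a b : R) (q dq : 'cV[R]_6) : 'M[R]_3 :=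
  diag_mx (\row_(i < 3) [:: C11 m I a b q dq; 0; 0]`_i).

(* Main.v *)
Require Import Defs.
From HB Require Import structures.
From mathcomp Require Import all_boot all_order all_algebra.
From mathcomp Require Import all_classical all_reals all_analysis.
From mathcomp Require Import lra.

Set Implicit Arguments.
Unset Strict Implicit.
Unset Printing Implicit Defensive.

Import Order.TTheory GRing.Theory Num.Theory.
Import numFieldNormedType.Exports.

Local Open Scope classical_set_scope.
Local Open Scope ring_scope.

(* Every entry is a polynomial in sines, cosines and steering rates, all bounded
   on the operating domain and Lipschitz in (q, dq); products of bounded
   Lipschitz functions are Lipschitz.  Only the (1,1) entries vary, so the
   operator norms reduce to absolute values of scalars. *)

(** The mean value theorem on [[y, x]]. The bound is symmetric in its two points, so they may be
    taken in order. *)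
Lemma ler_dist_mean_value (R : realType) (f df : R -> R) (k : R) :
  (forall x : R, is_derive x 1 f (df x)) -> (forall x, `|df x| <= k) ->
  forall x y, `|f x - f y| <= k * `|x - y|.
Proof.
move=> fdf dfk x y; wlog xy : x y / y <= x.
  move=> H; have [/H//|/ltW/H] := leP y x.
  by rewrite distrC (distrC y x).
have fcont : {within `[y, x], continuous f}.
  apply: continuous_subspaceT => z; apply/differentiable_continuous.
  by apply/derivable1_diffP; case: (fdf z).
have [c _ ->] := MVT_segment xy (fun z _ => fdf z) fcont.
by rewrite normrM ler_wpM2r.
Qed.

Lemma sin_dist_le (R : realType) (x y : R) : `|sin x - sin y| <= `|x - y|.
Proof.
by rewrite -[leRHS]mul1r; apply: ler_dist_mean_value => z; exact: cos_max.
Qed.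

Lemma cos_dist_le (R : realType) (x y : R) : `|cos x - cos y| <= `|x - y|.
Proof.
rewrite -[leRHS]mul1r; apply: ler_dist_mean_value => z.
by rewrite normrN; exact: sin_max.
Qed.

(** Insert the mixed product [x1 * y2]: each remaining difference is multiplied by a factor that one
    of the two bounds controls. *)
Lemma mul_dist_le (R : numDomainType) (X Y x1 x2 y1 y2 : R) :
  `|x1| <= X -> `|y2| <= Y ->
  `|x1 * y1 - x2 * y2| <= X * `|y1 - y2| + Y * `|x1 - x2|.
Proof.
move=> hX hY.
have -> : x1 * y1 - x2 * y2 = x1 * (y1 - y2) + y2 * (x1 - x2).
  by rewrite !mulrBr (mulrC y2 x1) (mulrC y2 x2) addrA subrK.
by apply: le_trans (ler_normD _ _) _; rewrite !normrM lerD // ler_wpM2r.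
Qed.

Lemma normrBB_le (R : numDomainType) (x1 x2 y1 y2 : R) :
  `|(x1 - y1) - (x2 - y2)| <= `|x1 - x2| + `|y1 - y2|.
Proof. by rewrite opprD addrACA -opprD; exact: ler_normB. Qed.

Lemma coord_le_norm2 (R : realType) (n : nat) (v : 'cV[R]_n) (i : 'I_n) :
  `|v i 0| <= norm2 v.
Proof.
rewrite -sqrtr_sqr /norm2 ler_wsqrtr // (bigD1 i) //= lerDl.
by apply: sumr_ge0 => j _; exact: sqr_ge0.
Qed.

(** Each coordinate of [v] is stretched by at most [c], hence so is [norm2 v], which is at most 1 on
    the unit ball. *)
Lemma opnorm2_diag_le (R : realType) (n : nat) (d : 'rV[R]_n) (c : R) :
  0 <= c -> (forall i, `|d 0 i| <= c) -> opnorm2 (diag_mx d) <= c.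
Proof.
move=> c0 dc; apply: ge_sup; first by case: (opnorm2_has_sup (diag_mx d)).
move=> _ [v /= v1 <-]; apply: (@le_trans _ _ (c * norm2 v)); last first.
  by rewrite -[leRHS]mulr1 ler_wpM2l.
rewrite -[c]ger0_norm // -sqrtr_sqr /norm2 -sqrtrM ?sqr_ge0 //.
rewrite ler_wsqrtr // mulr_sumr ler_sum // => i _.
rewrite mul_diag_mx mxE exprMn ler_wpM2r ?sqr_ge0 //.
by rewrite -[leLHS]real_normK ?num_real // ler_pXn2r ?nnegrE.
Qed.

(** The l1 distance in the steering coordinates, the only ones on which the entries depend. It
    serves for configurations and for velocities; all scalar estimates use it, and [norm2] enters
    only at the end. *)
Definition steering_dist (R : realType) (q1 q2 : 'cV[R]_6) : R :=
  `|delta_f q1 - delta_f q2| + `|delta_r q1 - delta_r q2|.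

Lemma steering_dist_le (R : realType) (q1 q2 : 'cV[R]_6) :
  steering_dist q1 q2 <= 2 * norm2 (q1 - q2).
Proof.
have h i : `|q1 i 0 - q2 i 0| <= norm2 (q1 - q2).
  by have := coord_le_norm2 (q1 - q2) i; rewrite !mxE.
by rewrite mulr_natl mulr2n; exact: lerD (h _) (h _).
Qed.

Lemma sinB_dist_le (R : realType) (q1 q2 : 'cV[R]_6) :
  `|(sin (delta_f q1) - sin (delta_r q1)) - (sin (delta_f q2) - sin (delta_r q2))|
    <= steering_dist q1 q2.
Proof.
by apply: le_trans (normrBB_le _ _ _ _) _; rewrite lerD // sin_dist_le.
Qed.

Lemma sinB_bound (R : realType) (x y : R) : `|sin x - sin y| <= 2.
Proof.
by apply: le_trans (ler_normB _ _) _; rewrite (natrD _ 1 1) lerD // sin_max.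
Qed.

Lemma M11_dist_le (R : realType) (m I Iphi r a b : R) (q1 q2 : 'cV[R]_6) :
  0 <= m -> 0 <= I ->
  `|M11 m I Iphi r a b q1 - M11 m I Iphi r a b q2|
    <= (m / 2 + 4 * (I * geomA a b ^+ 2)) * steering_dist q1 q2.
Proof.
move=> m0 I0; rewrite /M11.
have K0 : 0 <= I * geomA a b ^+ 2 by rewrite mulr_ge0 ?sqr_ge0.
move: (I * _) K0 => K K0.
have hc : `|cos (delta_f q1 - delta_r q1) - cos (delta_f q2 - delta_r q2)|
    <= steering_dist q1 q2.
  by apply: le_trans (cos_dist_le _ _) _; exact: normrBB_le.
have hs := sinB_dist_le q1 q2.
(* The square is a product of two equal factors, each bounded by 2 and 1-Lipschitz in
   [steering_dist], whence the constant 4. *)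
have := mul_dist_le (sin (delta_f q2) - sin (delta_r q2))
  (sin (delta_f q1) - sin (delta_r q1))
  (sinB_bound (delta_f q1) (delta_r q1)) (sinB_bound (delta_f q2) (delta_r q2)).
rewrite -!expr2; move: (steering_dist _ _) hs hc => e.
set s1 := sin _ - _; set s2 := sin _ - _; set c1 := cos _; set c2 := cos _.
move=> hs hc h2; have {}h2 : `|s1 ^+ 2 - s2 ^+ 2| <= 4 * e by lra.
set u := _ / _.
have -> : u + m / 2 * (1 + c1) + K * s1 ^+ 2 - (u + m / 2 * (1 + c2) + K * s2 ^+ 2)
  = m / 2 * (c1 - c2) + K * (s1 ^+ 2 - s2 ^+ 2) by lra.
have m2 : 0 <= m / 2 by rewrite divr_ge0.
apply: le_trans (ler_normD _ _) _.
rewrite (normrM (m / 2)) (normrM K) (ger0_norm K0) (ger0_norm m2) mulrDl.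
rewrite lerD //; first by rewrite ler_wpM2l.
by rewrite (mulrC 4) -mulrA ler_wpM2l.
Qed.

(** In the first product the sine factor is at most 2 and the rate factor at most [2 * D], which
    gives [4 * D * e + 2 * ed], where [e] and [ed] are the steering distances of the configurations
    and of the velocities. In the second the bounds are 1 and [2 * D], which gives [2 * D * e + ed].
    The weights are [K] and [m / 4]. *)
Lemma C11_dist_le (R : realType) (m I a b D : R) (q1 q2 dq1 dq2 : 'cV[R]_6) :
  0 <= m -> 0 <= I ->
  `|delta_f dq1| <= D -> `|delta_r dq1| <= D ->
  `|delta_f dq2| <= D -> `|delta_r dq2| <= D ->
  `|C11 m I a b q1 dq1 - C11 m I a b q2 dq2|
    <= (4 * (I * geomA a b ^+ 2) + m / 2) * D * steering_dist q1 q2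
       + (2 * (I * geomA a b ^+ 2) + m / 4) * steering_dist dq1 dq2.
Proof.
move=> m0 I0 f1 r1 f2 r2; rewrite /C11.
have K0 : 0 <= I * geomA a b ^+ 2 by rewrite mulr_ge0 ?sqr_ge0.
move: (I * _) K0 => K K0.
have hs := sinB_dist_le q1 q2.
have ht : `|(cos (delta_f q1) * delta_f dq1 - cos (delta_r q1) * delta_r dq1)
          - (cos (delta_f q2) * delta_f dq2 - cos (delta_r q2) * delta_r dq2)|
    <= steering_dist dq1 dq2 + D * steering_dist q1 q2.
  apply: le_trans (normrBB_le _ _ _ _) _.
  rewrite /steering_dist mulrDr addrACA lerD //.
    apply: le_trans (mul_dist_le _ _ (cos_max _) f2) _.
    by rewrite mul1r lerD2l ler_wpM2l ?cos_dist_le // (le_trans _ f2).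
  apply: le_trans (mul_dist_le _ _ (cos_max _) r2) _.
  by rewrite mul1r lerD2l ler_wpM2l ?cos_dist_le // (le_trans _ r2).
have ht2 : `|cos (delta_f q2) * delta_f dq2 - cos (delta_r q2) * delta_r dq2|
    <= 2 * D.
  apply: le_trans (ler_normB _ _) _.
  by rewrite mulr_natl mulr2n !normrM lerD // -[leRHS]mul1r ler_pM // cos_max.
have hP := mul_dist_le (sin (delta_f q2) - sin (delta_r q2))
  (cos (delta_f q1) * delta_f dq1 - cos (delta_r q1) * delta_r dq1)
  (sinB_bound (delta_f q1) (delta_r q1)) ht2.
have hw : `|delta_f dq2 - delta_r dq2| <= 2 * D.
  by apply: le_trans (ler_normB _ _) _; rewrite mulr_natl mulr2n lerD.
have hu : `|sin (delta_f q1 - delta_r q1) - sin (delta_f q2 - delta_r q2)|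
    <= steering_dist q1 q2.
  by apply: le_trans (sin_dist_le _ _) _; exact: normrBB_le.
have hQ := mul_dist_le (sin (delta_f q2 - delta_r q2)) (delta_f dq1 - delta_r dq1)
  (sin_max (delta_f q1 - delta_r q1)) hw.
have hv := normrBB_le (delta_f dq1) (delta_f dq2) (delta_r dq1) (delta_r dq2).
rewrite -/(steering_dist dq1 dq2) in hv.
have D0 : 0 <= D by exact: le_trans (normr_ge0 _) f1.
(* With these inequalities already multiplied by [D], the bounds on both products become linear in
   [D * e], within reach of [lra]. *)
have hs' := ler_wpM2l D0 hs; have hu' := ler_wpM2l D0 hu.
rewrite -!mulrA.
move: (steering_dist dq1 _) (steering_dist q1 _) hs ht hP hw hu hQ hv hs' hu'.
move=> ed e hs ht hP hw hu hQ hv hs' hu'.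
move: hP hQ.
set P1 := (sin _ - _) * _; set P2 := (sin _ - _) * _.
set Q1 := sin _ * _; set Q2 := sin _ * _ => hP hQ.
have {}hP : `|P1 - P2| <= 4 * D * e + 2 * ed by lra.
have {}hQ : `|Q1 - Q2| <= 2 * D * e + ed by lra.
have m4 : 0 <= m / 4 by rewrite divr_ge0.
have -> : K * P1 - m * (4^-1 * Q1) - (K * P2 - m * (4^-1 * Q2))
  = K * (P1 - P2) - m / 4 * (Q1 - Q2) by lra.
apply: le_trans (ler_normB _ _) _.
rewrite (normrM K) (normrM (m / 4)) (ger0_norm K0) (ger0_norm m4).
have := lerD (ler_wpM2l K0 hP) (ler_wpM2l m4 hQ); lra.
Qed.

Theorem mainTheorem8 (R : realType) (m I Iphi Idelta r a b : R)
    (hm : 0 < m) (hI : 0 < I) (hIphi : 0 < Iphi) (hIdelta : 0 < Idelta)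
    (hr : 0 < r) (ha : 0 < a) (hb : 0 < b)
    (Ddelta : set R) (hD : compact Ddelta)
    (ddelta_max : R) (hd : 0 < ddelta_max) :
  exists LM LC1 LC2 : R,
    [/\ 0 < LM, 0 < LC1, 0 < LC2 &
      forall q1 dq1 q2 dq2 : 'cV[R]_6,
        operating_domain Ddelta ddelta_max (q1, dq1) ->
        operating_domain Ddelta ddelta_max (q2, dq2) ->
        opnorm2 (Mtilde m I Iphi Idelta r a b q1
                 - Mtilde m I Iphi Idelta r a b q2)
          <= LM * norm2 (q1 - q2)
        /\
        opnorm2 (Ctilde m I a b q1 dq1 - Ctilde m I a b q2 dq2)
          <= LC1 * norm2 (q1 - q2) + LC2 * norm2 (dq1 - dq2)].
Proof.
pose K := I * geomA a b ^+ 2.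
have K0 : 0 <= K by rewrite mulr_ge0 ?sqr_ge0 // ltW.
have m0 := ltW hm; have I0 := ltW hI.
have LM0 : 0 < m / 2 + 4 * K by lra.
(* Strict positivity comes from the terms in [m], since [K] is only known to be nonnegative. *)
have LC10 : 0 < (4 * K + m / 2) * ddelta_max by rewrite mulr_gt0 //; lra.
have LC20 : 0 < 2 * K + m / 4 by lra.
(* The constants of the scalar estimates, doubled by the passage from [steering_dist] to [norm2]. *)
exists ((m / 2 + 4 * K) * 2), ((4 * K + m / 2) * ddelta_max * 2),
  ((2 * K + m / 4) * 2).
split; try exact: mulr_gt0.
move=> q1 dq1 q2 dq2 [/= _ _ f1 r1] [/= _ _ f2 r2].
have rhs_ge0 (k : R) (v : 'cV[R]_6) : 0 < k -> 0 <= k * 2 * norm2 v.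
  by move=> k0; rewrite !mulr_ge0 ?sqrtr_ge0 // ltW.
have steering_le (k : R) (v w : 'cV[R]_6) :
    0 < k -> k * steering_dist v w <= k * 2 * norm2 (v - w).
  by move=> k0; rewrite -mulrA ler_wpM2l ?steering_dist_le // ltW.
have M_ge0 := rhs_ge0 _ (q1 - q2) LM0.
have C_ge0 := addr_ge0 (rhs_ge0 _ (q1 - q2) LC10) (rhs_ge0 _ (dq1 - dq2) LC20).
(* A difference of diagonal matrices is diagonal. Its last two entries cancel, leaving the
   nonnegativity of the right-hand sides, and only the (1,1) entries remain to be estimated. *)
split; rewrite /Mtilde /Ctilde -raddfB /=; apply: opnorm2_diag_le => // i;
  rewrite !mxE; case: i => [[|[|[|//]]] ?] /=; rewrite ?subrr ?normr0 //.
  apply: le_trans (M11_dist_le _ _ _ _ _ _ m0 I0) _; exact: steering_le.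
apply: le_trans (C11_dist_le _ _ _ _ m0 I0 f1 r1 f2 r2) _.
by apply: lerD; exact: steering_le.
Qed.
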